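(* Let $\lambda$ be a real number, $\alpha>0$, and let $X$ be a zero-truncated degenerate Poisson random variable with parameter $\alpha$. Then for every positive integer $n$, $$E\big[(X)_n\big]=\frac{\alpha^n(1)_{n,\lambda}}{1-e_\lambda^{-1}(\alpha)}\cdot\frac{1}{(1+\lambda\alpha)^n}.$$
   Context: The falling factorial is $(x)_0=1$, $(x)_n=x(x-1)\cdots(x-n+1)$; the $\lambda$-falling factorial is $(x)_{0,\lambda}=1$, $(x)_{n,\lambda}=x(x-\lambda)\cdots(x-(n-1)\lambda)$ for $n\ge1$. The degenerate exponential is $e_\lambda^x(t)=\sum_{n\ge0}(x)_{n,\lambda}\frac{t^n}{n!}$ $(=(1+\lambda t)^{x/\lambda})$, $e_\lambda(t)=e_\lambda^1(t)$, $e_\lambda^{-1}(\alpha)=1/e_\lambda(\alpha)$ (for $\lambda=0$: $e^{xt}$). A zero-truncated degenerate Poisson random variable with parameter $\alpha>0$ is a random variable $X$ with $P\{X=k\}=\frac{1}{e_\lambda(\alpha)-1}\frac{\alpha^k}{k!}(1)_{k,\lambda}$ for $k=1,2,3,\dots$. *)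

(* Defs.v *)
From HB Require Import structures.
From mathcomp Require Import all_boot all_order all_algebra.
From mathcomp Require Import all_classical all_reals all_analysis.
Import Order.TTheory GRing.Theory Num.Theory.
Import numFieldNormedType.Exports.

Set Implicit Arguments.
Unset Strict Implicit.
Unset Printing Implicit Defensive.

Local Open Scope classical_set_scope.
Local Open Scope ring_scope.

Definition falling_fact (R : realType) (x : R) (n : nat) : R :=
  \prod_(i < n) (x - i%:R).

Definition lambda_falling_fact (R : realType) (lambda x : R) (n : nat) : R :=
  \prod_(i < n) (x - i%:R * lambda).

(* The degenerate exponential e_lambda^x(t), as the sum of its power series in
   t. Like any [limn], the value is only meaningful when the series converges;
   for [is_zt_degen_poisson] below, convergence at [t = alpha] is forced by the
   fact that the point masses are nonnegative and add up to 1. *)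
Definition degen_exp (R : realType) (lambda x t : R) : R :=
  limn (series (fun k : nat =>
    lambda_falling_fact lambda x k * (t ^+ k / k`!%:R))).

(* The first conjunct says that X takes its values in {1, 2, 3, ...} almost
   surely, so that the masses of the second one are the whole law of X. *)
Definition is_zt_degen_poisson d (T : measurableType d) (R : realType)
    (P : probability T R) (lambda alpha : R) (X : {RV P >-> R}) : Prop :=
  P [set w | exists2 k : nat, (0 < k)%N & X w = k%:R] = 1%E /\
  forall k : nat, (0 < k)%N ->
    P [set w | X w = k%:R] =
    ((degen_exp lambda 1 alpha - 1)^-1 *
     (alpha ^+ k / k`!%:R * lambda_falling_fact lambda 1 k))%:E.

(* Main.v *)
Require Import Defs.
From HB Require Import structures.
From mathcomp Require Import all_boot all_order all_algebra.
From mathcomp Require Import all_classical all_reals all_analysis.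
From mathcomp Require Import measurable_realfun ring lra.
Import Order.TTheory GRing.Theory Num.Theory.
Import numFieldNormedType.Exports.
Local Open Scope classical_set_scope.
Local Open Scope ring_scope.

(** Put S_n = sum_k (1)_{n+k,lambda} alpha^k/k!, so that S_0 = e_lambda(alpha).
    Since (k)_n/k! = 1/(k-n)! for k >= n and (k)_n = 0 for k < n, the factorial
    moment is alpha^n S_n / (e_lambda(alpha) - 1). From
    (1)_{n+1+k,lambda} = (1)_{n+k,lambda} (1 - n lambda - k lambda) one gets
    (1 + lambda alpha) S_{n+1} = (1 - n lambda) S_n, whence
    S_n = (1)_{n,lambda} e_lambda(alpha) / (1 + lambda alpha)^n. The positivity
    and convergence that this needs follow from the masses being nonnegative
    and adding up to 1: the former forces (1)_{k,lambda} >= 0 for all k, the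
    latter 1 + lambda alpha > 0. *)

Lemma falling_factE {R : realType} (k n : nat) :
  falling_fact (k%:R : R) n = (k ^_ n)%:R.
Proof.
elim: n => [|n IHn]; first by rewrite /falling_fact big_ord0 ffactn0.
rewrite /falling_fact big_ord_recr/= -/(falling_fact _ n) IHn ffactnSr natrM.
(* For [k < n] the truncated [k - n] differs from the real difference, but [k ^_ n] is already 0. *)
have [le_nk|lt_kn] := leqP n k; first by rewrite natrB.
by rewrite ffact_small// !mul0r.
Qed.

Lemma measurable_falling_fact {R : realType} (n : nat) :
  measurable_fun setT (fun x : R => falling_fact x n).
Proof.
by apply: measurable_prod => i _; exact: measurable_funB.
Qed.

Lemma lambda_falling_fact0 {R : realType} (lambda x : R) :
  lambda_falling_fact lambda x 0 = 1.
Proof. by rewrite /lambda_falling_fact big_ord0. Qed.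

Lemma lambda_falling_factS {R : realType} (lambda x : R) (n : nat) :
  lambda_falling_fact lambda x n.+1 =
  lambda_falling_fact lambda x n * (x - n%:R * lambda).
Proof. by rewrite /lambda_falling_fact big_ord_recr. Qed.

(** The terms of $S_n$, that is, of the [n]-th formal derivative in [t] of the series of
    $e_\lambda(t)$. *)
Definition degen_term {R : realType} (lambda t : R) (n k : nat) : R :=
  lambda_falling_fact lambda 1 (n + k) * (t ^+ k / k`!%:R).

(** The part $k\lambda$ of the new factor cancels against $k!$ and lowers the index by one, so the
    second sum stops one term earlier. Being exact on partial sums, the identity serves both to
    bound them and to pass to the limit. *)
Lemma series_degen_termS {R : realType} (lambda t : R) (n N : nat) :
  series (degen_term lambda t n.+1) N.+1 +
    lambda * t * series (degen_term lambda t n.+1) N =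
  (1 - n%:R * lambda) * series (degen_term lambda t n) N.+1.
Proof.
elim: N => [|N IHN].
  rewrite !seriesSr /series/= !big_geq// /degen_term !addn0.
  by rewrite lambda_falling_factS; ring.
rewrite seriesSr [X in _ + _ * X]seriesSr [in RHS]seriesSr.
rewrite mulrDr [in RHS]mulrDr -IHN.
rewrite /degen_term !addSn !addnS !lambda_falling_factS factS natrM exprS.
have Nfact0 : N`!%:R != 0 :> R by rewrite pnatr_eq0 -lt0n fact_gt0.
have NS0 : N%:R + 1 != 0 :> R by rewrite natr1 pnatr_eq0.
rewrite -!natr1 !natrD; field.
by rewrite Nfact0.
Qed.

Section degen_series.
Context {R : realType} {lambda t : R} (t_gt0 : 0 < t)
  (ff_ge0 : forall k, 0 <= lambda_falling_fact lambda 1 k).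

Lemma degen_term_ge0 n k : 0 <= degen_term lambda t n k.
Proof.
by rewrite mulr_ge0// divr_ge0 ?ler0n// exprn_ge0// ltW.
Qed.

(* If [lambda * t <= -1], the terms dominate [t] times the harmonic series. *)
Lemma degen_radius : cvgn (series (degen_term lambda t 0)) ->
  0 < 1 + lambda * t.
Proof.
move=> cv; rewrite ltNge; apply/negP => le0.
have lb k : t <= k.+1%:R * degen_term lambda t 0 k.+1.
  elim: k => [|k IHk].
    rewrite /degen_term lambda_falling_factS lambda_falling_fact0.
    by rewrite factS fact0 expr1 mul0r subr0 !mul1r divr1.
  apply: (le_trans IHk).
  (* As [lambda * t <= -1], the last factor is at least [t + k.+1%:R], hence at least [k.+1%:R]. *)
  have -> : k.+2%:R * degen_term lambda t 0 k.+2 =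
      degen_term lambda t 0 k.+1 * (t - k.+1%:R * (lambda * t)).
    rewrite /degen_term !add0n (lambda_falling_factS _ _ k.+1).
    rewrite (factS k.+1) natrM (exprS t k.+1).
    have f0 : (k.+1)`!%:R != 0 :> R by rewrite pnatr_eq0 -lt0n fact_gt0.
    have k0 : k.+2%:R != 0 :> R by rewrite pnatr_eq0.
    by field; rewrite f0 -natrD.
  rewrite mulrC ler_wpM2l ?degen_term_ge0//.
  have : k.+1%:R * (1 + lambda * t) <= 0 by rewrite mulr_ge0_le0.
  by rewrite mulrDr mulr1; move: t_gt0; lra.
apply: (@dvg_harmonic R).
have cvS : cvgn (series (fun k => degen_term lambda t 0 k.+1)).
  have -> : series (fun k => degen_term lambda t 0 k.+1) =
      (fun N => series (degen_term lambda t 0) N.+1 - degen_term lambda t 0 0).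
    apply/funext => N; rewrite /series/= [in RHS]big_nat_recl//.
    by rewrite addrAC subrr add0r.
  apply: is_cvgB; last exact: is_cvg_cst.
  apply/cvg_ex; exists (limn (series (degen_term lambda t 0))).
  by rewrite cvg_shiftS.
have cvt : cvgn (series (fun k => t^-1 * degen_term lambda t 0 k.+1)).
  have -> : series (fun k => t^-1 * degen_term lambda t 0 k.+1) =
      (fun N => t^-1 * series (fun k => degen_term lambda t 0 k.+1) N).
    by apply/funext => N; rewrite /series/= mulr_sumr.
  by apply: is_cvgM => //; exact: is_cvg_cst.
apply: series_le_cvg cvt => k.
- by rewrite /harmonic/= invr_ge0.
- by rewrite mulr_ge0 ?degen_term_ge0// invr_ge0 ltW.
- rewrite /harmonic/= -(@ler_pM2l _ t)// mulrA divff ?gt_eqF// mul1r.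
  by rewrite ler_pdivrMr ?ltr0n// mulrC.
Qed.

Lemma nondecreasing_series_degen_term n :
  {homo series (degen_term lambda t n) : N M / (N <= M)%N >-> N <= M}.
Proof. by apply: nondecreasing_series => k _ _; exact: degen_term_ge0. Qed.

Lemma cvg_series_degen_term (n : nat) (s : R) : 0 < 1 + lambda * t ->
  series (degen_term lambda t n) @ \oo --> s ->
  series (degen_term lambda t n.+1) @ \oo -->
    (1 - n%:R * lambda) * s / (1 + lambda * t).
Proof.
move=> rad cvs.
have homoS := @nondecreasing_series_degen_term.
have s_ge N : series (degen_term lambda t n) N <= s.
  rewrite -(cvg_lim _ cvs)//; apply: nondecreasing_cvgn_le => //.
  by apply/cvg_ex; exists s.
have T_ge0 m N : 0 <= series (degen_term lambda t m) N.
  by rewrite sumr_ge0// => k _; exact: degen_term_ge0.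
(* The recurrence bounds the partial sums [T_N] of the new series: for
   [lambda * t < 0], monotonicity gives [(1 + lambda * t) * T_(N+1) <=
   T_(N+1) + lambda * t * T_N]; for [0 <= lambda * t], the right-hand side is
   at least [T_(N+1)]. *)
have cvS : cvgn (series (degen_term lambda t n.+1)).
  apply: nondecreasing_is_cvgn => //.
  (* The norm is there because [1 - n%:R * lambda] can be negative once
     [lambda_falling_fact lambda 1 n] vanishes. *)
  exists (`|1 - n%:R * lambda| * s / Num.min 1 (1 + lambda * t)) => _ [N _ <-].
  rewrite ler_pdivlMr ?lt_min ?ltr01//.
  apply: (le_trans (y := `|1 - n%:R * lambda| *
      series (degen_term lambda t n) N.+1)); last by rewrite ler_wpM2l.
  rewrite -(ger0_norm (T_ge0 n N.+1)) -normrM -series_degen_termS.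
  apply: le_trans (ler_norm _).
  apply: (le_trans (y := Num.min 1 (1 + lambda * t) *
      series (degen_term lambda t n.+1) N.+1)).
    by rewrite mulrC ler_wpM2l ?le_min ?ler01 ?(ltW rad)// homoS.
  have le_T := homoS n.+1 N N.+1 (leqnSn N).
  have [l0|l0] := leP 0 (lambda * t).
    rewrite min_l; last by rewrite lerDl.
    by rewrite mul1r lerDl mulr_ge0.
  rewrite min_r; last by rewrite gerDl ltW.
  by rewrite mulrDl mul1r lerD2l ler_wnM2l// ltW.
move/cvg_ex : cvS => [l cvl].
suff -> : (1 - n%:R * lambda) * s / (1 + lambda * t) = l by [].
(* Both sides of the recurrence converge, and uniqueness of limits determines [l]. *)
have cvL : (series (degen_term lambda t n.+1) N.+1 +
    lambda * t * series (degen_term lambda t n.+1) N) @[N --> \oo] -->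
    l + lambda * t * l.
  apply: cvgD; first by rewrite cvg_shiftS.
  by apply: cvgM => //; exact: cvg_cst.
have cvR : ((1 - n%:R * lambda) * series (degen_term lambda t n) N.+1)
    @[N --> \oo] --> (1 - n%:R * lambda) * s.
  by apply: cvgM; [exact: cvg_cst | rewrite cvg_shiftS].
have /funext eqLR := series_degen_termS lambda t n.
rewrite eqLR in cvL.
have -> : (1 - n%:R * lambda) * s = l + lambda * t * l.
  by rewrite -(cvg_lim _ cvL)// (cvg_lim _ cvR).
by field; rewrite gt_eqF.
Qed.

Lemma cvg_series_degen_termE (n : nat) (s : R) :
  series (degen_term lambda t 0) @ \oo --> s ->
  series (degen_term lambda t n) @ \oo -->
    lambda_falling_fact lambda 1 n * s / (1 + lambda * t) ^+ n.
Proof.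
move=> cvs; have rad : 0 < 1 + lambda * t.
  by apply: degen_radius; apply/cvg_ex; exists s.
elim: n => [|n IHn].
  by rewrite lambda_falling_fact0 mul1r expr0 divr1.
have -> : lambda_falling_fact lambda 1 n.+1 * s / (1 + lambda * t) ^+ n.+1 =
    (1 - n%:R * lambda) * (lambda_falling_fact lambda 1 n * s /
      (1 + lambda * t) ^+ n) / (1 + lambda * t).
  rewrite lambda_falling_factS exprS.
  by field; rewrite expf_neq0 gt_eqF// gt_eqF.
exact: cvg_series_degen_term.
Qed.

End degen_series.

(** Almost surely [X] lies in a countable disjoint union of level sets, on each of which [g (X w)]
    is constant. The sign condition is confined to positive integers because falling factorials can
    be negative at other reals. *)
Lemma expectation_pos_nat {R : realType} (d : measure_display)
    (T : measurableType d) (P : probability T R) (X : {RV P >-> R})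
    (g : R -> R) :
  measurable_fun setT g -> (forall k, 0 <= g k.+1%:R) ->
  P [set w | exists2 k : nat, (0 < k)%N & X w = k%:R] = 1%E ->
  ('E_P[fun w => g (X w)] =
    \sum_(0 <= k <oo) ((g k.+1%:R)%:E * P [set w | X w = k.+1%:R]))%E.
Proof.
move=> mg g0 PA1.
set A := [set w | _] in PA1.
pose F k := [set w | X w = k.+1%:R].
have mF k : measurable (F k).
  exact: (measurable_funPTI X (measurable_set1 k.+1%:R)).
have AE : A = \bigcup_k F k.
  apply/seteqP; split => [w [[//|k] _ Xw]|w [k _ Xw]]; first by exists k.
  by exists k.+1.
have mA : measurable A by rewrite AE; exact: bigcup_measurable.
have mgX : measurable_fun setT (fun w => (g (X w))%:E).
  by apply/measurable_EFinP; exact: measurableT_comp.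
rewrite unlock (@ae_eq_integral _ _ _ P setT ((fun w => (g (X w))%:E) \_ A))//.
- rewrite -integral_mkcond AE ge0_integral_bigcup//.
  + apply: eq_eseriesr => k _.
    rewrite (eq_integral (cst (g k.+1%:R)%:E)) ?integral_cst//.
    by move=> w; rewrite inE => ->.
  + exact: measurable_funTS.
  + by move=> w [k _ ->]; rewrite lee_fin.
  + move=> i j _ _ [w [Xi Xj]]; apply/eqP.
    by rewrite -eqSS -(eqr_nat R) -Xi -Xj.
- apply/(measurable_restrictT _ mA); exact: measurable_funTS.
- exists (~` A); split; first exact: measurableC.
    by rewrite [LHS](probability_setC P mA) PA1 subee.
  move=> w /= nw Aw; apply: nw => _.
  by rewrite patchE mem_set.
Qed.

(** Nonnegative series always converge in the extended reals, so a finite value of the sum already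
    gives real convergence. *)
Lemma cvg_EFin_series {R : realType} (u : R^nat) (l : R) :
  (forall k, 0 <= u k) -> ((\sum_(0 <= k <oo) (u k)%:E)%E = l%:E) <->
  (series u @ \oo --> l).
Proof.
move=> u0; have E : (fun N => (\sum_(0 <= k < N) (u k)%:E)%E) = EFin \o series u.
  by apply/funext => N; rewrite /= sumEFin.
split=> [ul|cv].
  suff /fine_cvgP[] : EFin \o series u @ \oo --> l%:E by [].
  rewrite -E -ul; by apply: is_cvg_nneseries => k _ _; rewrite lee_fin.
rewrite E; apply: cvg_lim => //.
by apply: cvg_EFin; [exact: nearW|].
Qed.

Theorem theorem9 (R : realType) (d : measure_display) (T : measurableType d)
    (P : probability T R) (lambda alpha : R) (X : {RV P >-> R})
    (halpha : 0 < alpha) (hX : is_zt_degen_poisson lambda alpha X)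
    (n : nat) (hn : (0 < n)%N) :
  'E_P[fun w => falling_fact (X w) n]%E =
  (alpha ^+ n * lambda_falling_fact lambda 1 n /
     (1 - (degen_exp lambda 1 alpha)^-1) *
   (1 / (1 + lambda * alpha) ^+ n))%:E.
Proof.
case: hX => PX1 PXk.
pose a := degen_term lambda alpha 0.
set e := degen_exp lambda 1 alpha in PXk *.
pose C := (e - 1)^-1.
have PXS k : P [set w | X w = k.+1%:R] = (C * a k.+1)%:E.
  by rewrite PXk// /a /degen_term add0n [_ * lambda_falling_fact _ _ _]mulrC.
have Ca_ge0 k : 0 <= C * a k.+1 by rewrite -lee_fin -PXS.
have a0 : a 0%N = 1 by rewrite /a /degen_term lambda_falling_fact0 fact0 expr0; field.
have a1 : a 1%N = alpha.
  rewrite /a /degen_term lambda_falling_factS lambda_falling_fact0.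
  by rewrite factS fact0 expr1; field.
(* The masses add up to 1: this is the expectation of the constant 1. *)
have cv1 : series (fun k => C * a k.+1) @ \oo --> (1 : R).
  apply/cvg_EFin_series => //.
  have /= := @expectation_pos_nat _ _ _ P X (cst 1) _ _ PX1.
  rewrite -/(cst 1) expectation_cst => ->//.
  by apply: eq_eseriesr => k _; rewrite PXS mul1e.
(* [C = 0] would make the masses add up to 0; this also excludes [e = 1]. *)
have C_gt0 : 0 < C.
  rewrite lt_neqAle -(pmulr_lge0 _ halpha) -a1 Ca_ge0 andbT.
  apply/eqP => C0.
  have cv0 : series (fun k => C * a k.+1) @ \oo --> (0 : R).
    have -> : series (fun k => C * a k.+1) = cst 0.
      by apply/funext => N; rewrite /series/= big1// => k _; rewrite -C0 mul0r.
    exact: cvg_cst.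
  have := oner_neq0 R.
  by rewrite -(cvg_lim (@Rhausdorff R) cv1) (cvg_lim (@Rhausdorff R) cv0) eqxx.
have ff_ge0 k : 0 <= lambda_falling_fact lambda 1 k.
  case: k => [|k]; first by rewrite lambda_falling_fact0.
  have := Ca_ge0 k.
  rewrite pmulr_rge0// /a /degen_term add0n pmulr_lge0//.
  by rewrite divr_gt0 ?exprn_gt0// ltr0n fact_gt0.
(* [e] is a [limn], hence only now known to be the sum of its series. *)
have cva : series a @ \oo --> e.
  (* Here 1 is [a 0], and [C^-1] is the sum of the other terms by [cv1]. *)
  suff cv : series a @ \oo --> 1 + C^-1.
    suff -> : e = 1 + C^-1 by [].
    exact: cvg_lim cv.
  rewrite -cvg_shiftS.
  have -> : [sequence series a N.+1]_N =
      (fun N => 1 + C^-1 * series (fun k => C * a k.+1) N).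
    apply/funext => N /=; rewrite /series/= big_nat_recl// a0 -mulr_sumr.
    by rewrite mulKf// gt_eqF.
  apply: cvgD; first exact: cvg_cst.
  rewrite -[X in _ --> X]mulr1.
  by apply: cvgM => //; exact: cvg_cst.
have e_gt1 : 1 < e by rewrite -subr_gt0 -invr_gt0.
have cvn := cvg_series_degen_termE halpha ff_ge0 n _ cva.
have rad : 0 < 1 + lambda * alpha.
  by apply: (degen_radius halpha ff_ge0); apply/cvg_ex; exists e.
rewrite (@expectation_pos_nat _ _ _ P X (fun x => falling_fact x n) _ _ PX1).
- under eq_eseriesr do rewrite PXS -EFinM.
  apply/cvg_EFin_series.
    by move=> k; rewrite falling_factE mulr_ge0.
  (* The summands of the moment, with index 0 added: since [0 < n], [v 0] vanishes. Dropping all [n]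
     leading zeros leaves a multiple of $S_n$. *)
  pose v k := falling_fact (k%:R : R) n * (C * a k).
  have v0 k : (k < n)%N -> v k = 0.
    by move=> kn; rewrite /v falling_factE ffact_small// mul0r.
  have vn k : v (k + n)%N = C * alpha ^+ n * degen_term lambda alpha n k.
    rewrite /v falling_factE /a /degen_term add0n addnC exprD.
    have := ffact_fact (leq_addr k n); rewrite addKn => <-.
    rewrite natrM.
    have k0 : k`!%:R != 0 :> R by rewrite pnatr_eq0 -lt0n fact_gt0.
    have kn0 : ((n + k) ^_ n)%:R != 0 :> R.
      by rewrite pnatr_eq0 -lt0n ffact_gt0 leq_addr.
    by field; rewrite k0.
  have -> : series (fun k => falling_fact (k.+1%:R : R) n * (C * a k.+1)) =
      [sequence series v N.+1]_N.
    by apply/funext => N; rewrite /series/= [in RHS]big_nat_recl// v0// add0r.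
  rewrite cvg_shiftS -(cvg_shiftn n).
  have -> : [sequence series v (N + n)%N]_N =
      (fun N => C * alpha ^+ n * series (degen_term lambda alpha n) N).
    apply/funext => N; rewrite /series/= mulr_sumr.
    rewrite (big_cat_nat _ (n := n)) ?leq_addl//= big_nat big1 ?add0r; last first.
      by move=> k /andP[_]; exact: v0.
    rewrite -{1}[n]add0n big_addn addnK.
    by apply: eq_bigr => k _; exact: vn.
  (* This rests on [C * e = 1 / (1 - e^-1)]. *)
  have -> : alpha ^+ n * lambda_falling_fact lambda 1 n / (1 - e^-1) *
      (1 / (1 + lambda * alpha) ^+ n) = C * alpha ^+ n *
      (lambda_falling_fact lambda 1 n * e / (1 + lambda * alpha) ^+ n).
    have e0 : e != 0 by rewrite gt_eqF// (lt_trans ltr01).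
    have e1 : e - 1 != 0 by rewrite gt_eqF// subr_gt0.
    by rewrite /C; field; rewrite e0 e1 expf_neq0// gt_eqF.
  by apply: cvgM => //; exact: cvg_cst.
- exact: measurable_falling_fact.
- by move=> k; rewrite falling_factE.
Qed.
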